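(* Let $p$ be a lattice norm on $\mathbb{R}^2$ with $p((1,0))=p((0,1))=1$, and let $\Phi$ be an Orlicz function which does not satisfy the suitable $\Delta_2$-condition (relative to $(\Omega,\Sigma,\mu)$). Then for every $\varepsilon>0$ there exists a linear operator $P_\varepsilon:\ell^\infty\to L^\Phi(\mu)$ which is nonnegative (i.e. $P_\varepsilon z\ge0$ a.e. whenever $z\ge0$ coordinatewise) and satisfies $$\|z\|_\infty\le\|P_\varepsilon z\|_{\Phi,p}\le(1+\varepsilon)\|z\|_\infty\qquad\text{for all }z\in\ell^\infty.$$
   Context: $(\Omega,\Sigma,\mu)$ is a $\sigma$-finite complete measure space; all atoms are assumed to have measure $1$ and the set of atoms is either finite or countably infinite (identified with $\mathbb{N}$). Write $\Omega_a$ for the union of atoms and $\Omega_{na}=\Omega\setminus\Omega_a$. $L^0$ is the space of (classes of a.e. equal) real measurable functions. An Orlicz function is a function $\Phi:\mathbb{R}\to[0,\infty)$ which is convex, even, vanishes at $0$ and is not identically zero. $I_\Phi(x)=\int_\Omega\Phi(x(t))\,d\mu\in[0,+\infty]$; $L^\Phi(\mu)=\{x\in L^0: I_\Phi(\lambda x)<\infty\text{ for some }\lambda>0\}$. A lattice norm on $\mathbb{R}^2$ is a norm $p$ with $p((u,v))\le p((u',v'))$ whenever $|u|\le|u'|,|v|\le|v'|$; $\|x\|_{\Phi,p}=\inf_{k>0}\frac1k p((1,I_\Phi(kx)))$ with the convention $p((1,+\infty))=+\infty$. $\Phi\in\Delta_2(\mathbb{R}_+)$ means there is $K>0$ with $\Phi(2u)\le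 K\Phi(u)$ for all $u\ge0$; $\Phi\in\Delta_2(\infty)$ means there are $u_0,K>0$ with $\Phi(2u)\le K\Phi(u)$ for all $u\ge u_0$; $\Phi\in\Delta_2(0)$ means there are $u_0,K>0$ with $\Phi(2u)\le K\Phi(u)$ for all $u\in[0,u_0]$. The suitable $\Delta_2$-condition is: $\Delta_2(\mathbb{R}_+)$ if $\mu$ is non-atomic and $\mu(\Omega)=\infty$; $\Delta_2(\infty)$ if $\mu$ is non-atomic and finite; $\Delta_2(0)$ if $\Omega=\mathbb{N}$ with counting measure; if $\mu(\Omega_{na})>0$ and there are finitely many atoms, the condition suitable for the non-atomic part $\Omega_{na}$; if $\mu(\Omega_{na})>0$ and the atoms form a copy of $\mathbb{N}$, the conjunction of the condition suitable for $\Omega_{na}$ and $\Delta_2(0)$. *)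

(* Defs.v *)
From HB Require Import structures.
From mathcomp Require Import all_boot all_order all_algebra.
From mathcomp Require Import all_classical all_reals all_analysis.
Set Implicit Arguments. Unset Strict Implicit. Unset Printing Implicit Defensive.
Import Order.TTheory GRing.Theory Num.Theory.
Import numFieldNormedType.Exports.
Local Open Scope classical_set_scope.
Local Open Scope ring_scope.

Section Defs.
Context {R : realType}.

Section MS.
Context {d : measure_display} {T : measurableType d}.
Variable mu : {measure set T -> \bar R}.

Definition is_atom (A : set T) : Prop :=
  measurable A /\ (0 < mu A)%E /\
  forall B, measurable B -> B `<=` A -> mu B = 0%E \/ mu (A `\` B) = 0%E.

Definition complete_measure : Prop :=
  forall N, measurable N -> mu N = 0%E -> forall M, M `<=` N -> measurable M.

(* index set of the atoms: {k | k < n} if Nat = Some n, all of nat if None *)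
Definition in_idx (Nat : option nat) (k : nat) : bool :=
  if Nat is Some n then (k < n)%N else true.

Definition Omega_a (Nat : option nat) (A : nat -> set T) : set T :=
  \bigcup_(k in [set k | in_idx Nat k]) A k.

Definition Omega_na (Nat : option nat) (A : nat -> set T) : set T :=
  ~` Omega_a Nat A.

Definition standing_assumptions (Nat : option nat) (A : nat -> set T) : Prop :=
  [/\ sigma_finite setT mu /\ complete_measure,
      (forall B, is_atom B -> mu B = 1%E),
      (forall k, in_idx Nat k -> is_atom (A k)),
      (forall k l, in_idx Nat k -> in_idx Nat l -> k <> l -> A k `&` A l = set0)
    & (forall B, B `<=` Omega_na Nat A -> ~ is_atom B)].

End MS.

Definition convex_fun (Phi : R -> R) : Prop :=
  forall x y t : R, 0 <= t <= 1 ->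
    Phi (t * x + (1 - t) * y) <= t * Phi x + (1 - t) * Phi y.

Definition orlicz_function (Phi : R -> R) : Prop :=
  [/\ (forall u, 0 <= Phi u), convex_fun Phi, (forall u, Phi (- u) = Phi u),
      Phi 0 = 0 & exists u, Phi u <> 0].

Definition Delta2_Rplus (Phi : R -> R) : Prop :=
  exists K : R, 0 < K /\ forall u, 0 <= u -> Phi (2 * u) <= K * Phi u.

Definition Delta2_infty (Phi : R -> R) : Prop :=
  exists u0 K : R, [/\ 0 < u0, 0 < K &
    forall u, u0 <= u -> Phi (2 * u) <= K * Phi u].

Definition Delta2_zero (Phi : R -> R) : Prop :=
  exists u0 K : R, [/\ 0 < u0, 0 < K &
    forall u, 0 <= u <= u0 -> Phi (2 * u) <= K * Phi u].

(* the suitable Delta_2 condition; m_na = mu(Omega_na), Nat describes the atoms *)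
Definition suitable_Delta2 (Phi : R -> R) (m_na : \bar R) (Nat : option nat)
  : Prop :=
  ((0 < m_na)%E ->
     (m_na = +oo%E -> Delta2_Rplus Phi) /\ ((m_na < +oo)%E -> Delta2_infty Phi))
  /\ (Nat = None -> Delta2_zero Phi).

Definition lattice_norm (p : R -> R -> R) : Prop :=
  [/\ (forall u v, p u v = 0 -> u = 0 /\ v = 0),
      (forall a u v, p (a * u) (a * v) = `|a| * p u v),
      (forall u v u' v', p (u + u') (v + v') <= p u v + p u' v')
    & (forall u v u' v', `|u| <= `|u'| -> `|v| <= `|v'| -> p u v <= p u' v')].

Definition p_ext (p : R -> R -> R) (w : \bar R) : \bar R :=
  match w with
  | EFin r => (p 1 r)%:E
  | +oo%E => +oo%E
  | -oo%E => +oo%E (* never used: the modular is nonnegative *)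
  end.

Section OrliczSpace.
Context {d : measure_display} {T : measurableType d}.
Variable mu : {measure set T -> \bar R}.

Definition modular (Phi : R -> R) (x : T -> R) : \bar R :=
  (\int[mu]_t (Phi (x t))%:E)%E.

Definition in_LPhi (Phi : R -> R) (x : T -> R) : Prop :=
  measurable_fun setT x /\
  exists lam : R, 0 < lam /\ (modular Phi (fun t => (lam * x t)%R) < +oo)%E.

Definition orlicz_pnorm (Phi : R -> R) (p : R -> R -> R) (x : T -> R) : \bar R :=
  ereal_inf [set ((k^-1)%R)%:E * p_ext p (modular Phi (fun t => (k * x t)%R))
            | k in [set k : R | (0 < k)%R]]%E.
End OrliczSpace.

Definition bounded_seq (z : nat -> R) : Prop :=
  exists M : R, forall n, `|z n| <= M.

Definition linf_norm (z : nat -> R) : R := sup (range (fun n => `|z n|)).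

End Defs.

(* Main.v *)
(* If Delta_2 fails in the relevant range, then for each factor
   lam_m = 1 + 1/(m+1) the ratio Phi(lam_m u) / Phi(u) is unbounded there, since
   a bound could be iterated up to the factor 2.  Hence there are u_m >= 0 and
   disjoint sets E_m with Phi(u_m) mu(E_m) <= eps / 2^(m+1) and
   Phi(lam_m u_m) mu(E_m) >= 1.  On the nonatomic part, Sierpinski's theorem
   provides E_m of measure exactly 1 / Phi(lam_m u_m); on the atoms, E_m is a
   union of finitely many of them.  Send z to the function equal to
   z_(c(m)) u_m on E_m, where c takes every value infinitely often: its modular
   is at most eps when |z| <= 1, and infinite as soon as |z_n| > 1 for some n,
   so its norm lies between sup |z| and (1 + eps) sup |z|. *)
Require Import Defs.
From mathcomp Require Import all_boot all_order all_algebra.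
From mathcomp Require Import all_classical all_reals all_analysis.
From mathcomp Require Import measurable_realfun ring lra.
Import Order.TTheory GRing.Theory Num.Theory.
Local Open Scope classical_set_scope.
Local Open Scope ring_scope.

(** * Dependent choice and growth of powers *)

Lemma dependent_choice_nat (S : Type) (P : nat -> S -> Prop)
    (Q : nat -> S -> S -> Prop) (x0 : S) :
  P 0%N x0 -> (forall n x, P n x -> exists y, P n.+1 y /\ Q n x y) ->
  exists f : nat -> S,
    f 0%N = x0 /\ forall n, P n (f n) /\ Q n (f n) (f n.+1).
Proof.
move=> P0 step.
(* Choosing on pairs (n, x), with a vacuous requirement where [P n x] fails, yields a total step
   function to iterate. *)
have [|g gP] := @choice (nat * S)%type S
  (fun nx y => P nx.1 nx.2 -> P nx.1.+1 y /\ Q nx.1 nx.2 y).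
  move=> [n x] /=; have [/step[y Py]|nP] := pselect (P n x); first by exists y.
  by exists x.
pose f := fix f n := if n is m.+1 then g (m, f m) else x0.
have Pf n : P n (f n) by elim: n => [//|n IH]; exact: (gP (n, f n) IH).1.
by exists f; split => // n; split => //; exact: (gP (n, f n) (Pf n)).2.
Qed.

(** Bernoulli's inequality n (x - 1) <= x^n, combined with the Archimedean property. *)
Lemma exists_expr_ge (R : realType) (x M : R) : 1 < x -> exists n, M <= x ^+ n.
Proof.
move=> x1; have [n Mn] : exists n, M / (x - 1) <= n%:R.
  exists (Num.bound `|M / (x - 1)|); apply: (le_trans (ler_norm _)).
  exact: (ltW (archi_boundP (normr_ge0 _))).
exists n; rewrite ler_pdivrMr ?subr_gt0// in Mn.
apply: (le_trans Mn); rewrite -[in leRHS](subrK 1 x).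
elim: n {Mn} => [|n IH]; first by rewrite mul0r.
rewrite exprS -natr1 mulrDl mul1r.
have : 1 <= (x - 1 + 1) ^+ n by rewrite exprn_ege1// subrK ltW.
nra.
Qed.

(** * Orlicz functions and the failure of the doubling conditions *)

Section Orlicz.
Context {R : realType}.
Implicit Types (Phi : R -> R) (u x y lam K : R).

Lemma orlicz_contract Phi : orlicz_function Phi ->
  forall t u, 0 <= t <= 1 -> Phi (t * u) <= t * Phi u.
Proof.
move=> [_ cvx _ Phi0 _] t u t01.
by have := cvx u 0 t t01; rewrite !mulr0 Phi0 mulr0 !addr0.
Qed.

Lemma orlicz_dilate Phi : orlicz_function Phi ->
  forall t u, 1 <= t -> t * Phi u <= Phi (t * u).
Proof.
move=> oPhi t u t1; have t0 : 0 < t by lra.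
have := @orlicz_contract _ oPhi t^-1 (t * u).
rewrite invr_ge0 (ltW t0) invf_le1// t1 mulKf ?gt_eqF// => /(_ isT).
by rewrite mulrC ler_pdivlMr// mulrC.
Qed.

Lemma orlicz_homo Phi : orlicz_function Phi ->
  forall x y, 0 <= x -> x <= y -> Phi x <= Phi y.
Proof.
move=> oPhi x y x0 xy; have [y0|y0] := leP y 0; first by have -> : x = y by lra.
have t01 : 0 <= x / y <= 1.
  by rewrite divr_ge0 ?(ltW y0)//= ler_pdivrMr// mul1r.
have := @orlicz_contract _ oPhi (x / y) y t01; rewrite divfK ?gt_eqF//.
have Py : 0 <= Phi y by case: oPhi.
by move: t01 => /andP[t0 t1]; move=> /le_trans; apply; rewrite ler_piMl.
Qed.

(** From a point w > 0 with Phi w > 0, convexity forces at least linear growth along the ray through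
    w. *)
Lemma orlicz_unbounded Phi : orlicz_function Phi ->
  forall M, exists2 u0, 0 < u0 & forall u, u0 <= u -> M <= Phi u.
Proof.
move=> oPhi M; have [ge0 _ ev Phi0 [v Pv]] := oPhi.
have [w w0 Pw] : exists2 w, 0 < w & 0 < Phi w.
  have Pv0 : 0 < Phi v by rewrite lt0r ge0 andbT; apply/eqP.
  have [v0|v0|v0] := ltgtP v 0; last by rewrite v0 Phi0 ltxx in Pv0.
    by exists (- v); [rewrite oppr_gt0|rewrite ev].
  by exists v.
pose t := Num.max 1 (M / Phi w).
have t1 : 1 <= t by rewrite le_max lexx.
exists (t * w) => [|u tu]; first by rewrite mulr_gt0// (lt_le_trans ltr01).
apply: (@le_trans _ _ (t * Phi w)).
  by rewrite -ler_pdivrMr// le_max lexx orbT.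
apply: (le_trans (orlicz_dilate _ oPhi _ _ t1)); apply: orlicz_homo => //.
by rewrite mulr_ge0 ?ltW// (lt_le_trans ltr01).
Qed.

Lemma orlicz_small Phi : orlicz_function Phi ->
  forall M, 0 < M -> exists2 u0, 0 < u0 & forall u, 0 <= u <= u0 -> Phi u <= M.
Proof.
move=> oPhi M M0; have P1 : 0 <= Phi 1 by case: oPhi.
have D0 : 0 < Phi 1 + M by rewrite ltr_wpDl.
(* This threshold is at most 1, so Phi u <= u Phi 1 below it, and it makes sense even when Phi 1 =
   0. *)
exists (M / (Phi 1 + M)) => [|u /andP[u0 uM]]; first by rewrite divr_gt0.
have u1 : u <= 1 by rewrite (le_trans uM)// ler_pdivrMr// mul1r lerDr.
have := @orlicz_contract _ oPhi u 1; rewrite mulr1 u0 u1 => /(_ isT)/le_trans; apply.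
rewrite ler_pdivlMr// in uM; nra.
Qed.

(** The bound for the factor [lam] is chained along u, lam u, ..., lam^n u, whose last point is at
    least 2 u. Asking for it only on this orbit lets one lemma serve all three ranges of u. *)
Lemma doubling_of_dilation Phi lam K n u : orlicz_function Phi ->
  1 <= lam -> 0 <= K -> 2 <= lam ^+ n -> 0 <= u ->
  (forall j, (j < n)%N ->
     Phi (lam * (lam ^+ j * u)) <= K * Phi (lam ^+ j * u)) ->
  Phi (2 * u) <= K ^+ n * Phi u.
Proof.
move=> oPhi lam1 K0 lam2 u0 H.
apply: (@le_trans _ _ (Phi (lam ^+ n * u))).
  by apply: orlicz_homo => //; [rewrite mulr_ge0|rewrite ler_wpM2r].
elim: n {lam2} H => [|n IH] H; first by rewrite !expr0 !mul1r.
rewrite !exprS -!mulrA; apply: (le_trans (H n (ltnSn n))).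
by rewrite ler_wpM2l// IH// => j jn; apply: H; exact: ltnW.
Qed.

Lemma Delta2_Rplus_fails Phi lam K : orlicz_function Phi ->
  ~ Delta2_Rplus Phi -> 1 < lam -> 0 < K ->
  exists2 u, 0 <= u & K * Phi u < Phi (lam * u).
Proof.
move=> oPhi nD lam1 K0; apply: contrapT => nex; apply: nD.
have [n n2] := @exists_expr_ge _ lam 2 lam1.
exists (K ^+ n); split=> [|u u0]; first exact: exprn_gt0.
apply: (@doubling_of_dilation _ lam) => //; [exact: ltW..|move=> j _].
rewrite leNgt; apply/negP => lt; apply: nex.
by exists (lam ^+ j * u); rewrite // mulr_ge0// exprn_ge0// (le_trans ler01)// ltW.
Qed.

Lemma Delta2_infty_fails Phi lam K u0 : orlicz_function Phi ->
  ~ Delta2_infty Phi -> 1 < lam -> 0 < K -> 0 < u0 ->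
  exists2 u, u0 <= u & K * Phi u < Phi (lam * u).
Proof.
move=> oPhi nD lam1 K0 u00; apply: contrapT => nex; apply: nD.
have [n n2] := @exists_expr_ge _ lam 2 lam1.
exists u0, (K ^+ n); split=> // [|u u0u]; first exact: exprn_gt0.
have uge0 : 0 <= u by rewrite (le_trans (ltW u00)).
apply: (@doubling_of_dilation _ lam) => //; [exact: ltW..|move=> j _].
rewrite leNgt; apply/negP => lt; apply: nex.
(* The orbit only moves upwards, so it stays in the range above u0. *)
exists (lam ^+ j * u) => //; rewrite (le_trans u0u)// ler_peMl//.
by rewrite exprn_ege1// ltW.
Qed.

Lemma Delta2_zero_fails Phi lam K u0 : orlicz_function Phi ->
  ~ Delta2_zero Phi -> 1 < lam -> 0 < K -> 0 < u0 ->
  exists2 u, 0 <= u <= u0 & K * Phi u < Phi (lam * u).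
Proof.
move=> oPhi nD lam1 K0 u00; apply: contrapT => nex; apply: nD.
have [n n2] := @exists_expr_ge _ lam 2 lam1.
have lam0 : 0 < lam by rewrite (lt_trans ltr01).
(* The threshold is shrunk by lam^n to keep the whole orbit of u below u0. *)
exists (u0 / lam ^+ n), (K ^+ n); split=> [||u /andP[uge0 uu0]].
- by rewrite divr_gt0// exprn_gt0.
- exact: exprn_gt0.
apply: (@doubling_of_dilation _ lam) => //; [exact: ltW..|move=> j jn].
rewrite leNgt; apply/negP => lt; apply: nex.
exists (lam ^+ j * u) => //; rewrite mulr_ge0 ?exprn_ge0 ?(ltW lam0)//=.
rewrite ler_pdivlMr ?exprn_gt0// in uu0; apply: le_trans uu0.
by rewrite mulrC ler_wpM2l// ler_eXn2l// ltnW.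
Qed.

End Orlicz.

(** * Nonatomic measures: Sierpinski's theorem and disjoint sets of prescribed measure *)

Section Nonatomic.
Context {R : realType} {d : measure_display} {T : measurableType d}.
Variable mu : {measure set T -> \bar R}.
Implicit Types (B D E F : set T).

Definition nonatomic_on D : Prop := forall B, B `<=` D -> ~ is_atom mu B.

Lemma measure_setDK D B : measurable D -> measurable B -> B `<=` D ->
  mu D = (mu (D `\` B) + mu B)%E.
Proof. by move=> mD mB BD; rewrite (measureDI mu mD mB) (setIidr BD). Qed.

(** Since B is not an atom, it splits into two pieces of positive measure, and the smaller one is
    kept. Writing the bound as a sum avoids dividing a possibly infinite measure. *)
Lemma nonatomic_split D B : nonatomic_on D -> measurable B -> B `<=` D ->
  (0 < mu B)%E -> exists C, [/\ measurable C, C `<=` B,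
    (0 < mu C)%E & (mu C + mu C <= mu B)%E].
Proof.
move=> nD mB BD muB.
have [C [mC CB C0 BC0]] : exists C, [/\ measurable C, C `<=` B,
    (0 < mu C)%E & (0 < mu (B `\` C))%E].
  apply: contrapT => nex; apply: (nD B BD); split=> //; split=> // C mC CB.
  apply: contrapT => /not_orP[/eqP C0 /eqP BC0]; apply: nex; exists C.
  by split=> //; rewrite lt0e measure_ge0 andbT.
have muE : mu B = (mu (B `\` C) + mu C)%E.
  exact: measure_setDK.
have [CBC|BCC] := leP (mu C) (mu (B `\` C)).
  by exists C; split=> //; rewrite muE leeD2r.
exists (B `\` C); split=> //; first exact: measurableD.
by rewrite muE leeD2l// ltW.
Qed.

Lemma nonatomic_small D eta : sigma_finite setT mu -> nonatomic_on D ->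
  measurable D -> (0 < mu D)%E -> 0 < eta ->
  exists F, [/\ measurable F, F `<=` D, (0 < mu F)%E & (mu F <= eta%:E)%E].
Proof.
move=> [G GT mG] nD mD muD eta0.
(* Halving has to start from a finite measure, which sigma-finiteness supplies: D cannot meet every
   set of the cover in a null set. *)
have [n Gn0] : exists n, (0 < mu (D `&` G n))%E.
  apply: contrapT => nex; suff : mu D = 0%E by move=> D0; rewrite D0 ltxx in muD.
  apply/negligibleP => //; rewrite -[D]setIT GT setI_bigcupr.
  apply: negligible_bigcup => k; apply/negligibleP.
    by apply: measurableI => //; case: (mG k).
  apply/eqP; rewrite -measure_le0 leNgt; apply/negP => k0.
  by apply: nex; exists k.
have mGn : measurable (D `&` G n) by apply: measurableI => //; case: (mG n).
have Gnoo : (mu (D `&` G n) < +oo)%E.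
  apply: (@le_lt_trans _ _ (mu (G n))); last by case: (mG n).
  by apply: le_measure; rewrite ?inE//; case: (mG n).
pose r := fine (mu (D `&` G n)).
have rE : mu (D `&` G n) = r%:E by rewrite fineK// ge0_fin_numE.
have halve k : exists F, [/\ measurable F, F `<=` D, (0 < mu F)%E &
    (mu F <= (r / 2 ^+ k)%:E)%E].
  elim: k => [|k [F [mF FD F0 Fr]]].
    by exists (D `&` G n); split=> //; rewrite expr0 divr1 rE.
  have [C [mC CF C0 CCF]] := nonatomic_split _ _ nD mF FD F0.
  exists C; split=> //; first exact: subset_trans FD.
  have := le_trans CCF Fr.
  have : mu C \is a fin_num.
    rewrite ge0_fin_numE//; apply: (@le_lt_trans _ _ (mu F)).
      by apply: le_measure; rewrite ?inE.
    exact: le_lt_trans Fr (ltry _).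
  move=> /fineK <-; rewrite -EFinD !lee_fin exprSr invfM mulrA; lra.
have [k k2] := @exists_expr_ge _ 2 (r / eta) (ltr1n _ 2).
have [F [mF FD F0 Fr]] := halve k.
exists F; split=> //; apply: (le_trans Fr); rewrite lee_fin.
by rewrite ler_pdivrMr ?exprn_gt0// mulrC -ler_pdivrMr.
Qed.

(* The next set of an exhaustion of [D] up to measure [a]: it captures at least
   half of what can still be added to [X]. *)
Lemma greedy_extension D a X : measurable D -> measurable X -> X `<=` D ->
  (mu X <= a%:E)%E ->
  exists Y, [/\ measurable Y, X `<=` Y, Y `<=` D, (mu Y <= a%:E)%E &
    forall F, measurable F -> F `<=` D `\` X -> (mu X + mu F <= a%:E)%E ->
      (mu X + mu X + mu F <= mu Y + mu Y)%E].
Proof.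
move=> mD mX XD Xa.
have fin B : (mu B <= a%:E)%E -> mu B \is a fin_num.
  by move=> Ba; rewrite ge0_fin_numE// (le_lt_trans Ba)// ltry.
pose ok F := [/\ measurable F, F `<=` D `\` X & (mu X + mu F <= a%:E)%E].
have okfin F : ok F -> mu F \is a fin_num.
  by case=> _ _ h; apply: fin; apply: le_trans h; rewrite leeDr.
pose S := [set fine (mu F) | F in ok].
have S0 : S 0.
  by exists set0; rewrite /ok measure0//; split=> //; rewrite adde0.
have ubS : ubound S a.
  move=> _ [F okF <-]; rewrite -lee_fin fineK; last exact: okfin.
  by case: okF => _ _; apply: le_trans; rewrite leeDr.
have supS : has_sup S by split; [exists 0|exists a].
have le_supS x : S x -> x <= sup S by apply: ub_le_sup; exists a.
(* The empty set serves when the supremum is not positive; otherwise some admissible set exceeds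
   half of it. *)
have [G [mG GDX Ga] GS] : exists2 G, ok G & sup S / 2 <= fine (mu G).
  have [s0|s0] := leP (sup S) 0.
    exists set0; first by split=> //; rewrite measure0 adde0.
    by rewrite measure0 /=; lra.
  have [|_ [G okG <-] lt] := @sup_adherent _ S (sup S / 2) _ supS.
    by rewrite divr_gt0.
  by exists G => //; lra.
have XG : X `&` G = set0.
  by apply/seteqP; split=> // t [Xt /GDX[]].
have YE : mu (X `|` G) = (mu X + mu G)%E by rewrite measureU.
exists (X `|` G); split=> //.
- exact: measurableU.
- by move=> t [/XD//|/GDX[]].
- by rewrite YE.
move=> F mF FDX Fa.
have okF : ok F by [].
have okG : ok G by [].
have := le_supS _ (ex_intro2 _ _ F okF erefl); rewrite YE.
rewrite -(fineK (okfin _ okF)) -(fineK (okfin _ okG)) -(fineK (fin _ Xa)).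
rewrite -!EFinD lee_fin /=; lra.
Qed.

(** Greedy exhaustion: E is the union of the sets built by [greedy_extension]. If mu E < a, a set F
    in D \ E with 0 < mu F <= a - mu E is admissible at every stage, so every stage gains at least
    mu F / 2, and the measures eventually exceed a. *)
Lemma sierpinski D a : sigma_finite setT mu -> nonatomic_on D ->
  measurable D -> 0 <= a -> (a%:E <= mu D)%E ->
  exists E, [/\ measurable E, E `<=` D & mu E = a%:E].
Proof.
move=> sf nD mD a0 aD.
pose P (n : nat) X := [/\ measurable X, X `<=` D & (mu X <= a%:E)%E].
pose Q (n : nat) X Y := X `<=` Y /\
  forall F, measurable F -> F `<=` D `\` X -> (mu X + mu F <= a%:E)%E ->
      (mu X + mu X + mu F <= mu Y + mu Y)%E.
have [||X [X0 PQ]] := @dependent_choice_nat _ P Q set0.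
- by split=> //; rewrite measure0 lee_fin.
- move=> n Z [mZ ZD Za].
  by have [Y [mY ZY YD Ya H]] := greedy_extension _ _ _ mD mZ ZD Za; exists Y.
have mX n : measurable (X n) by case: (PQ n) => -[].
have XD n : X n `<=` D by case: (PQ n) => -[].
have Xa n : (mu (X n) <= a%:E)%E by case: (PQ n) => -[].
pose E := \bigcup_n X n.
have mE : measurable E by exact: bigcup_measurable.
have ED : E `<=` D by apply: bigcup_sub => n _; exact: XD.
have Ea : (mu E <= a%:E)%E.
  (* Continuity from below carries the bound a over to the union. *)
  have cv : mu \o X @ \oo --> mu E.
    apply: nondecreasing_cvg_mu => //; apply/nondecreasing_seqP => n.
    by apply/subsetPset; case: (PQ n) => _ [].
  rewrite -(cvg_lim _ cv)//; apply: lime_le; first by apply/cvg_ex; exists (mu E).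
  by apply: nearW => n; exact: Xa.
exists E; split=> //; apply/eqP; rewrite eq_le Ea/= leNgt; apply/negP => Elt.
have Efin : mu E \is a fin_num by rewrite ge0_fin_numE// (lt_trans Elt)// ltry.
have DE0 : (0 < mu (D `\` E))%E.
  rewrite lt0e measure_ge0 andbT; apply/eqP => DE0.
  have := lt_le_trans Elt aD.
  by rewrite (measure_setDK _ _ mD mE ED) DE0 add0e ltxx.
have eta0 : 0 < a - fine (mu E).
  by rewrite subr_gt0 -lte_fin fineK.
have [|F [mF FDE F0 Feta]] :=
  @nonatomic_small (D `\` E) _ sf _ (measurableD mD mE) DE0 eta0.
  by move=> B BDE; apply: nD; apply: subset_trans BDE _; exact: subDsetl.
have Ffin : mu F \is a fin_num by rewrite ge0_fin_numE// (le_lt_trans Feta)// ltry.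
have Xfin n : mu (X n) \is a fin_num.
  by rewrite ge0_fin_numE// (le_lt_trans (Xa n))// ltry.
have Xgrow n : n%:R * (fine (mu F) / 2) <= fine (mu (X n)).
  elim: n => [|n IH]; first by rewrite mul0r fine_ge0.
  have [_ [_ /(_ F mF)]] := PQ n.
  have FX : F `<=` D `\` X n.
    move=> t /FDE[Dt nEt]; split=> // Xt; apply: nEt.
    by exists n.
  have XF : (mu (X n) + mu F <= a%:E)%E.
    have XE : (mu (X n) <= mu E)%E.
      by apply: le_measure; rewrite ?inE//; exact: bigcup_sup.
    apply: (le_trans (leeD XE Feta)).
    by rewrite -{1}(fineK Efin) -EFinD lee_fin; lra.
  move=> /(_ FX XF).
  rewrite -(fineK (Xfin n)) -(fineK (Xfin n.+1)) -(fineK Ffin) -!EFinD lee_fin.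
  rewrite -natr1; move: IH; lra.
have f0 : 0 < fine (mu F) / 2.
  by rewrite divr_gt0// -lte_fin fineK.
pose n := Num.bound `|a / (fine (mu F) / 2)|.
have nlt : a / (fine (mu F) / 2) < n%:R.
  apply: (le_lt_trans (ler_norm _)); exact: (archi_boundP (normr_ge0 _)).
have := Xgrow n; have := Xa n; rewrite -(fineK (Xfin n)) lee_fin.
rewrite ltr_pdivrMr// in nlt; lra.
Qed.

(** The sets are the increments of a nested sequence in D; the bound on partial sums guarantees that
    what remains of D has room for the next increment. *)
Lemma nonatomic_disjoint_seq D (a : nat -> R) : sigma_finite setT mu ->
  nonatomic_on D -> measurable D -> (forall n, 0 <= a n) ->
  (forall n, ((\sum_(i < n) a i)%:E <= mu D)%E) ->
  exists E : nat -> set T, [/\ (forall n, measurable (E n)),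
    trivIset setT E & forall n, mu (E n) = (a n)%:E].
Proof.
move=> sf nD mD a0 aD.
pose P (n : nat) X := [/\ measurable X, X `<=` D & mu X = (\sum_(i < n) a i)%:E].
pose Q (n : nat) X Y := X `<=` Y /\ mu (Y `\` X) = (a n)%:E.
have [||X [X0 PQ]] := @dependent_choice_nat _ P Q set0.
- by split=> //; rewrite measure0 big_ord0.
- move=> n X [mX XD Xn].
  have DE : mu D = (mu (D `\` X) + (\sum_(i < n) a i)%:E)%E.
    by rewrite (measure_setDK _ _ mD mX XD) Xn.
  have [||F [mF FDX Fa]] := @sierpinski (D `\` X) (a n) sf _ (measurableD mD mX) (a0 n).
  + by move=> B BDX; apply: nD; apply: subset_trans BDX _; exact: subDsetl.
  + by have := aD n.+1; rewrite DE big_ord_recr/= addrC EFinD leeD2rE.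
  have XF : X `&` F = set0 by apply/seteqP; split=> // t [Xt /FDX[]].
  exists (X `|` F); split; first split.
  + exact: measurableU.
  + by move=> t [/XD//|/FDX[]].
  + have -> : mu (X `|` F) = (mu X + mu F)%E by rewrite measureU.
    by rewrite Xn Fa big_ord_recr.
  split; first exact: subsetUl.
  rewrite setDUl setDv set0U (_ : F `\` X = F)//.
  by apply/setDidPl; rewrite setIC.
have ndX : nondecreasing_seq X.
  by apply/nondecreasing_seqP => n; apply/subsetPset; case: (PQ n) => _ [].
exists (fun n => X n.+1 `\` X n); split=> [n||n].
- by apply: measurableD; [case: (PQ n.+1) => -[]|case: (PQ n) => -[]].
(* In [seqD X] the difference of X (n+1) and X n sits at index n+1, hence the shift. *)
- move=> i j _ _ ij; have := @trivIset_seqD _ X ndX i.+1 j.+1 I I ij.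
  by case.
- by case: (PQ n) => _ [].
Qed.

End Nonatomic.

(** * Step functions on countably many disjoint sets and their integrals *)

Section StepFunctions.
Context {R : realType} {d : measure_display} {T : measurableType d}.
Variable mu : {measure set T -> \bar R}.
Implicit Types (E : nat -> set T) (g : nat -> R).

(** Index 0 is reserved for the points outside all the sets, so a step function becomes the
    composition of a sequence with [i]. *)
Lemma exists_index E : (forall n, measurable (E n)) -> trivIset setT E ->
  exists i : T -> nat, (forall n, i @^-1` [set n.+1] = E n) /\
    forall n, measurable (i @^-1` [set n]).
Proof.
move=> mE tE.
pose i t := if pselect (exists n, E n t) is left h then (sval (cid h)).+1 else 0%N.
have iE n : i @^-1` [set n.+1] = E n.
  apply/seteqP; split=> t; rewrite /i /=.
    case: pselect => [h|//] [<-]; exact: svalP (cid h).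
  move=> Ent; case: pselect => [h|nh]; last by exfalso; apply: nh; exists n.
  by case: cid => k /= Ekt; congr S; apply: tE => //; exists t.
exists i; split=> // -[|n]; last by rewrite iE.
have -> : i @^-1` [set 0%N] = ~` \bigcup_n E n.
  apply/seteqP; split=> t; rewrite /i /=.
    by case: pselect => // nh _ [n _ Ent]; apply: nh; exists n.
  by case: pselect => // -[n Ent] []; exists n.
exact/measurableC/bigcup_measurable.
Qed.

Lemma measurable_index_comp d' (T' : sigmaRingType d') (g : nat -> T')
    (i : T -> nat) :
  (forall n, measurable (i @^-1` [set n])) ->
  measurable_fun setT (fun t => g (i t)).
Proof.
move=> mi _ Y mY; rewrite setTI.
have -> : (fun t => g (i t)) @^-1` Y = \bigcup_(n in g @^-1` Y) i @^-1` [set n].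
  by apply/seteqP; split=> [t Yt|t [n /[swap] /= <-]] //; exists (i t).
exact: bigcup_measurable.
Qed.

(** The integral is summed over the level sets of [i]. The level 0, possibly of infinite measure,
    contributes nothing because g 0 = 0. *)
Lemma integral_index E (i : T -> nat) g :
  (forall n, i @^-1` [set n.+1] = E n) ->
  (forall n, measurable (i @^-1` [set n])) ->
  (forall n, 0 <= g n) -> g 0%N = 0 ->
  (\int[mu]_t (g (i t))%:E = \sum_(n <oo) (g n.+1)%:E * mu (E n))%E.
Proof.
move=> iE mi g0 g00.
have mE n : measurable (E n) by rewrite -iE.
have iT : \bigcup_n i @^-1` [set n] = [set: T].
  by apply/seteqP; split=> // t _; exists (i t).
rewrite -[in LHS]iT ge0_integral_bigcup//=; last 3 first.
- by rewrite iT; exact: (@measurable_index_comp _ _ (EFin \o g)).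
- by move=> t _; rewrite lee_fin.
- exact: trivIset_preimage1.
have cstI n : (\int[mu]_(t in i @^-1` [set n]) (g (i t))%:E =
    (g n)%:E * mu (i @^-1` [set n]))%E.
  rewrite -integral_cst//; apply: eq_integral => t.
  by rewrite inE /= => ->.
under eq_eseriesr do rewrite cstI.
have ge0 n : (0 <= (g n)%:E * mu (i @^-1` [set n]))%E.
  by rewrite mule_ge0// lee_fin.
rewrite nneseries_recl// g00 mul0e add0e.
rewrite -(nneseries_addn 1%N ge0).
apply: eq_eseriesr => n _; rewrite addn1 iE//.
Qed.

Lemma nneseries_frequently_ge1 (a : nat -> \bar R) : (forall n, 0 <= a n)%E ->
  (forall N, exists2 n, (N <= n)%N & (1 <= a n)%E) ->
  (\sum_(n <oo) a n = +oo)%E.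
Proof.
move=> a0 freq.
(* Each further term that is at least 1 raises the partial sums by 1, so they pass every integer. *)
have part k : exists N, (k%:R%:E <= \sum_(0 <= n < N) a n)%E.
  elim: k => [|k [N kN]]; first by exists 0%N; rewrite big_nil.
  have [n Nn an] := freq N; exists n.+1.
  rewrite big_nat_recr//= -natr1 EFinD leeD//; apply: (le_trans kN).
  by apply: lee_sum_nneg_natr.
apply/eqyP => M M0.
have [N] := part (Num.bound `|M|).
move=> h; apply: (@le_trans _ _ (\sum_(0 <= n < N) a n)%E).
  apply: le_trans h; rewrite lee_fin; apply: (le_trans (ler_norm _)).
  exact: (ltW (archi_boundP (normr_ge0 _))).
exact: nneseries_lim_ge.
Qed.

End StepFunctions.

(** * The copy of l^infty carried by suitable disjoint sets *)

(** The 2-adic valuation takes every value infinitely often, for instance n at 2^n (2 N + 1). It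
    serves to distribute the coordinates of z over the supports. *)
Lemma logn2_frequently (n N : nat) : exists2 m, (N <= m)%N & logn 2 m = n.
Proof.
exists (2 ^ n * N.*2.+1)%N.
  rewrite (@leq_trans N.*2.+1)//; last by rewrite leq_pmull// expn_gt0.
  by rewrite -addnn ltnW// ltnS leq_addr.
rewrite lognM ?expn_gt0// pfactorK// logn_coprime ?addn0//.
by rewrite coprime2n /= odd_double.
Qed.

(** Monotonicity gives the lower bound, the triangle inequality the upper one. The norm estimates
    use [p] only through these bounds. *)
Lemma lattice_norm_bounds (R : realType) (p : R -> R -> R) (r : R) :
  lattice_norm p -> p 1 0 = 1 -> p 0 1 = 1 -> 0 <= r -> 1 <= p 1 r <= 1 + r.
Proof.
move=> [_ ph pD pm] p10 p01 r0; apply/andP; split.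
  by rewrite -[leLHS]p10; apply: pm => //; rewrite normr0.
have := pD 1 0 0 r; rewrite addr0 add0r p10.
by have := ph r 0 1; rewrite mulr0 mulr1 p01 mulr1 ger0_norm// => ->.
Qed.

(* [x_n] is supported by the sets [E m] with [logn 2 m = n]: each index occurs
   infinitely often, which makes the modular of [lam * x_n] infinite for every
   [lam > 1]. *)
Lemma linf_copy (R : realType) (d : measure_display) (T : measurableType d)
    (mu : {measure set T -> \bar R}) (p : R -> R -> R) (Phi : R -> R) (eps : R)
    (E : nat -> set T) (a u : nat -> R) :
  lattice_norm p -> p 1 0 = 1 -> p 0 1 = 1 -> orlicz_function Phi -> 0 < eps ->
  (forall n, measurable (E n)) -> trivIset setT E ->
  (forall n, mu (E n) = (a n)%:E) -> (forall n, 0 <= u n) ->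
  (forall n, Phi (u n) * a n <= eps / (2 ^ n.+1)%:R) ->
  (forall n, 1 <= Phi ((1 + n.+1%:R^-1) * u n) * a n) ->
  exists P : (nat -> R) -> T -> R,
    [/\ (forall z, bounded_seq z -> in_LPhi mu Phi (P z)),
        (forall z w (a b : R), bounded_seq z -> bounded_seq w ->
           {ae mu, forall t, P (fun n => a * z n + b * w n) t
                             = a * P z t + b * P w t}),
        (forall z, bounded_seq z -> (forall n, 0 <= z n) ->
           {ae mu, forall t, 0 <= P z t})
      & (forall z, bounded_seq z ->
           ((linf_norm z)%:E <= orlicz_pnorm mu Phi p (P z))%E /\
           (orlicz_pnorm mu Phi p (P z) <= ((1 + eps) * linf_norm z)%:E)%E)].
Proof.
move=> lp p10 p01 oPhi eps0 mE tE muE u0 small large.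
have [Phi0 _ ev Phi00 _] := oPhi.
have Phi_norm x : Phi x = Phi `|x|.
  by case: (ger0P x) => // _; rewrite ev.
have a0 n : 0 <= a n by rewrite -lee_fin -muE.
have [i [iE mi]] := exists_index _ mE tE.
pose c (z : nat -> R) m := if m is n.+1 then z (logn 2 n) * u n else 0.
pose P z t := c z (i t).
have modE z k : modular mu Phi (fun t => k * P z t) =
    (\sum_(n <oo) (Phi (k * (z (logn 2 n) * u n)) * a n)%:E)%E.
  rewrite /modular (integral_index _ E i (fun m => Phi (k * c z m)))//=; last first.
    by rewrite mulr0.
  by apply: eq_eseriesr => n _; rewrite EFinM -muE.
have mod_ge0 z k : (0 <= modular mu Phi (fun t => (k * P z t)%R))%E.
  by apply: integral_ge0 => t _; rewrite lee_fin.
have mod_small z (k : R) : 0 < k -> (forall n, k * `|z n| <= 1) ->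
    (modular mu Phi (fun t => (k * P z t)%R) <= eps%:E)%E.
  move=> k0 kz; rewrite modE.
  (* The series of the eps / 2^(n+1) is at most eps. *)
  apply: le_trans (@epsilon_trick0 _ _ xpredT (ltW eps0)).
  apply: lee_nneseries => n _; first by rewrite lee_fin mulr_ge0.
  rewrite lee_fin; apply: le_trans (small n); apply: ler_wpM2r => //.
  rewrite Phi_norm; apply: orlicz_homo => //.
  by rewrite !normrM (gtr0_norm k0) (ger0_norm (u0 n)) mulrA ler_piMl.
have mod_large z (k : R) n : 0 < k -> 1 < k * `|z n| ->
    modular mu Phi (fun t => (k * P z t)%R) = +oo%E.
  move=> k0 kz; rewrite modE; apply: nneseries_frequently_ge1 => [m|N].
    by rewrite lee_fin mulr_ge0.
  (* For m >= M the factor 1 + 1/(m+1) is at most k |z_n|, so the term at such an m with valuation n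
     is at least 1. *)
  pose M := Num.bound `|(k * `|z n| - 1)^-1|.
  have [m Mm mn] := logn2_frequently n (maxn N M).
  rewrite geq_max in Mm; move/andP: Mm => [Nm Mm].
  exists m => //; rewrite lee_fin; apply: le_trans (large m) _.
  apply: ler_wpM2r => //; rewrite [leRHS]Phi_norm; apply: orlicz_homo => //.
    by rewrite mulr_ge0// addr_ge0.
  rewrite !normrM (gtr0_norm k0) (ger0_norm (u0 m)) mn mulrA ler_wpM2r//.
  rewrite -lerBrDl -[leRHS]invrK lef_pV2 ?posrE ?invr_gt0 ?subr_gt0//.
  apply: (le_trans (ler_norm _)); apply: ltW.
  apply: (lt_le_trans (archi_boundP (normr_ge0 _))).
  by rewrite ler_nat ltnW.
have le_linf (z : nat -> R) : bounded_seq z -> forall n, `|z n| <= linf_norm z.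
  move=> [M zM] n; apply: ub_le_sup; last by exists n.
  by exists M => _ [k _ <-].
have linf0 (z : nat -> R) : bounded_seq z -> 0 <= linf_norm z.
  by move=> bz; exact: (le_trans (normr_ge0 (z 0%N)) (le_linf z bz 0%N)).
(* The strict inequality keeps L positive even for z = 0. *)
have small_scale (z : nat -> R) L : bounded_seq z -> linf_norm z < L -> 0 < L /\
    (modular mu Phi (fun t => (L^-1 * P z t)%R) <= eps%:E)%E.
  move=> bz zL; have L0 : 0 < L by apply: le_lt_trans zL; exact: linf0.
  split=> //; apply: mod_small; rewrite ?invr_gt0// => n.
  by rewrite mulrC ler_pdivrMr// mul1r (le_trans (le_linf z bz n))// ltW.
exists P; split.
- move=> z bz; split; first exact: measurable_index_comp.
  have [|L0 modL] := small_scale z (linf_norm z + 1) bz; first by rewrite ltrDl.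
  exists (linf_norm z + 1)^-1; rewrite invr_gt0; split=> //.
  exact: le_lt_trans modL (ltry eps).
- move=> z w b1 b2 _ _; apply: aeW => t; rewrite /P /c.
  by case: (i t) => [|n]; [rewrite !mulr0 addr0|ring].
- move=> z _ z0; apply: aeW => t; rewrite /P /c.
  by case: (i t) => [|n] //; rewrite mulr_ge0.
move=> z bz; split.
  apply: le_ereal_inf_tmp => _ [k /= k0 <-].
  (* Either some k |z_n| > 1 and the modular is infinite, or 1/k is at least the sup norm while p
     (1, r) >= 1. *)
  have [[n kz]|kz] := pselect (exists n, 1 < k * `|z n|).
    by rewrite (mod_large z k n)//= gt0_muley ?leey// lte_fin invr_gt0.
  have zk : linf_norm z <= k^-1.
    apply: ge_sup; first by exists `|z 0%N|, 0%N.
    move=> _ [n _ <-]; rewrite -[leRHS]mul1r ler_pdivlMr// mulrC leNgt.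
    by apply/negP => kzn; apply: kz; exists n.
  case: (modular _ _ _) (mod_ge0 z k) => [r||]//= r0; last first.
    by rewrite gt0_muley ?leey// lte_fin invr_gt0.
  have /andP[p1 _] := lattice_norm_bounds _ _ r lp p10 p01 r0.
  rewrite -EFinM lee_fin (le_trans zk)// ler_peMr// invr_ge0 ltW//.
apply/lee_addgt0Pr => e e0.
have eps1 : 0 < 1 + eps by rewrite addr_gt0.
(* Testing the infimum at k = 1/L gives at most L (1 + eps), which is (1 + eps) times the sup norm,
   plus e. *)
pose L := linf_norm z + e / (1 + eps).
have zL : linf_norm z < L by rewrite ltrDl divr_gt0.
have [L0 modL] := small_scale z L bz zL.
apply: (@le_trans _ _ ((L^-1)^-1%:E *
    p_ext p (modular mu Phi (fun t => (L^-1 * P z t)%R)))%E).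
  by apply: ereal_inf_lbound; exists L^-1 => //=; rewrite invr_gt0.
case: (modular _ _ _) (mod_ge0 z L^-1) modL => [r||]//= r0.
rewrite !lee_fin in r0 * => rle.
have /andP[_ p1] := lattice_norm_bounds _ _ r lp p10 p01 r0.
rewrite invrK.
have -> : (1 + eps) * linf_norm z + e = L * (1 + eps).
  by rewrite /L; field; rewrite gt_eqF.
by rewrite ler_pM2l//; lra.
Qed.

(** * Supports obtained from each failing doubling condition *)

Section DisjointSupports.
Context {R : realType} {d : measure_display} {T : measurableType d}.
Variables (mu : {measure set T -> \bar R}) (Phi : R -> R) (eps : R).
Hypotheses (oPhi : orlicz_function Phi) (eps0 : 0 < eps).
Let lam (n : nat) : R := 1 + n.+1%:R^-1.

(** The input of [linf_copy], isolated so that each failing condition can be treated separately. *)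
Definition Delta2_failing_supports : Prop :=
  exists (E : nat -> set T) (a u : nat -> R),
    [/\ (forall n, measurable (E n)) /\ trivIset setT E,
        forall n, mu (E n) = (a n)%:E,
        forall n, 0 <= u n,
        forall n, Phi (u n) * a n <= eps / (2 ^ n.+1)%:R
      & forall n, 1 <= Phi (lam n * u n) * a n].

Let lam_gt1 n : 1 < lam n.
Proof. by rewrite /lam ltrDl invr_gt0. Qed.

(** With a ratio Phi (lam_n u) / Phi u above this constant, a set of measure 1 / Phi (lam_n u) meets
    both requirements on the n-th support. *)
Let K (n : nat) : R := (2 ^ n.+1)%:R / eps.

Let K_gt0 n : 0 < K n.
Proof. by rewrite divr_gt0// ltr0n expn_gt0. Qed.

(** The last condition on u bounds the n-th measure a_n = 1 / Phi (lam_n u_n) by mu D / 2^(n+1), so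
    that all the supports fit into D together. *)
Lemma nonatomic_supports (D : set T) : sigma_finite setT mu ->
  nonatomic_on mu D -> measurable D ->
  (forall n, exists u, [/\ 0 <= u, K n * Phi u < Phi (lam n * u) &
     (((2 ^ n.+1)%:R / Phi (lam n * u))%:E <= mu D)%E]) ->
  Delta2_failing_supports.
Proof.
move=> sf nD mD /choice[u uP].
have Phi_ge0 x : 0 <= Phi x by case: oPhi.
pose a n := (Phi (lam n * u n))^-1.
have Phi_gt0 n : 0 < Phi (lam n * u n).
  by have [_ + _] := uP n; apply: le_lt_trans; rewrite mulr_ge0// ltW.
have a_le n : (((2 ^ n.+1)%:R * a n)%:E <= mu D)%E by case: (uP n).
have sum_le n : ((\sum_(i < n) a i)%:E <= mu D)%E.
  case: (mu D) a_le => [M||] aM; last 2 first.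
  - by rewrite leey.
  - by have := aM 0%N.
  (* M - M / 2^n is the sum of M / 2^(i+1) over i < n, a form suited to induction. *)
  rewrite lee_fin; apply: (@le_trans _ _ (M - M / (2 ^ n)%:R)); last first.
    rewrite gerBl divr_ge0//; have := aM 0%N; rewrite lee_fin; apply: le_trans.
    by rewrite mulr_ge0// invr_ge0 ltW.
  elim: n => [|n IH]; first by rewrite big_ord0 expn0 divr1 subrr.
  rewrite big_ord_recr/=; have := aM n; rewrite lee_fin expnS natrM.
  have e0 : 0 < (2 ^ n)%:R :> R by rewrite ltr0n expn_gt0.
  rewrite mulrC -ler_pdivlMr ?mulr_gt0// => an.
  apply: (le_trans (lerD IH an)); rewrite le_eqVlt; apply/orP; left; apply/eqP.
  by field; rewrite gt_eqF.
have a_ge0 n : 0 <= a n by rewrite invr_ge0 ltW.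
have [E [mE tE muE]] := nonatomic_disjoint_seq mu D a sf nD mD a_ge0 sum_le.
exists E, a, u; split=> // n; first by case: (uP n).
  have [_ /ltW + _] := uP n; rewrite /a ler_pdivrMr// mulrC.
  rewrite -ler_pdivlMr// => /le_trans; apply.
  by rewrite /K invf_div mulrC.
by rewrite /a divff// gt_eqF.
Qed.

Lemma Delta2_Rplus_supports (D : set T) : sigma_finite setT mu ->
  nonatomic_on mu D -> measurable D -> mu D = +oo%E -> ~ Delta2_Rplus Phi ->
  Delta2_failing_supports.
Proof.
move=> sf nD mD Doo nDelta; apply: (@nonatomic_supports D) => // n.
have [u u0 Ku] := Delta2_Rplus_fails _ _ _ oPhi nDelta (lam_gt1 n) (K_gt0 n).
by exists u; rewrite Doo leey.
Qed.

Lemma Delta2_infty_supports (D : set T) : sigma_finite setT mu ->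
  nonatomic_on mu D -> measurable D -> (0 < mu D < +oo)%E ->
  ~ Delta2_infty Phi -> Delta2_failing_supports.
Proof.
move=> sf nD mD /andP[D0 Doo] nDelta; apply: (@nonatomic_supports D) => // n.
have Dfin : mu D \is a fin_num by rewrite ge0_fin_numE.
have fD0 : 0 < fine (mu D) by rewrite fine_gt0// D0.
(* Beyond this u0 the values of Phi are so large that the n-th support takes at most the fraction 1
   / 2^(n+1) of D. *)
have [u0 u00 Pu] := orlicz_unbounded _ oPhi ((2 ^ n.+1)%:R / fine (mu D)).
have [u u0u Ku] :=
  Delta2_infty_fails _ _ _ _ oPhi nDelta (lam_gt1 n) (K_gt0 n) u00.
have uge0 : 0 <= u by rewrite (le_trans (ltW u00)).
exists u; split=> //; rewrite -(fineK Dfin) lee_fin.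
have Plam : (2 ^ n.+1)%:R / fine (mu D) <= Phi (lam n * u).
  by apply: Pu; rewrite (le_trans u0u)// ler_peMl// ltW.
have Plam0 : 0 < Phi (lam n * u).
  by apply: lt_le_trans Plam; rewrite divr_gt0// ltr0n expn_gt0.
by rewrite ler_pdivrMr// mulrC -ler_pdivrMr.
Qed.

(** Unions of atoms only have integer measures, so 1 / Phi (lam_n u_n) is replaced by a larger
    integer. As Phi (lam_n u_n) <= 1, this costs at most a factor 2, which the ratio 2 K_n
    absorbs. *)
Lemma Delta2_zero_supports (A : nat -> set T) : (forall k, measurable (A k)) ->
  (forall k, mu (A k) = 1%E) -> trivIset setT A -> ~ Delta2_zero Phi ->
  Delta2_failing_supports.
Proof.
move=> mA muA tA nDelta.
have Phi_ge0 x : 0 <= Phi x by case: oPhi.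
have /choice[u uP] : forall n, exists u : R, [/\ 0 <= u,
    2 * K n * Phi u < Phi (lam n * u) & Phi (lam n * u) <= 1].
  move=> n.
  have [v v0 Pv] := orlicz_small _ oPhi 1 ltr01.
  have lam0 : 0 < lam n by rewrite (lt_trans ltr01).
  (* Dividing v by lam_n ensures lam_n u <= v, hence Phi (lam_n u) <= 1. *)
  have [||u /andP[u0 uv] Ku] :=
    Delta2_zero_fails _ _ (2 * K n) (v / lam n) oPhi nDelta (lam_gt1 n).
  - by rewrite mulr_gt0.
  - by rewrite divr_gt0.
  exists u; split=> //; apply: Pv; rewrite mulr_ge0 ?(ltW lam0)//=.
  by rewrite mulrC -ler_pdivlMr.
have Phi_gt0 n : 0 < Phi (lam n * u n).
  have [_ + _] := uP n; apply: le_lt_trans.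
  by rewrite mulr_ge0// mulr_ge0// ltW.
pose N n := (Num.truncn (Phi (lam n * u n))^-1).+1.
have N_gt n : (Phi (lam n * u n))^-1 <= (N n)%:R by rewrite ltW// truncnS_gt.
have N_le n : (N n)%:R <= 2 / Phi (lam n * u n).
  have [_ _ P1] := uP n.
  have : 1 <= (Phi (lam n * u n))^-1 by rewrite invf_ge1.
  have : (Num.truncn (Phi (lam n * u n))^-1)%:R <= (Phi (lam n * u n))^-1.
    by rewrite truncn_le ?invr_ge0.
  rewrite /N -natr1; lra.
(* Coding pairs by integers gives each n its own infinite stock of atoms, which makes the unions
   disjoint. *)
pose E n := \big[setU/set0]_(j < N n) A (pickle (n, j : nat)).
have EP n t : E n t -> exists j : nat, A (pickle (n, j)) t.
  rewrite /E; elim: (N n) => [|m IH]; first by rewrite big_ord0.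
  by rewrite big_ord_recr/= => -[/IH//|At]; exists m.
have pickle_inj : injective (@pickle (nat * nat)%type).
  exact: pcan_inj pickleK.
exists E, (fun n => (N n)%:R), u; split=> [|n|n|n|n]; last 3 first.
- by case: (uP n).
- have [_ /ltW Ku _] := uP n.
  apply: le_trans (ler_wpM2l (Phi_ge0 _) (N_le n)) _.
  rewrite mulrA ler_pdivrMr// -ler_pdivrMl ?divr_gt0 ?ltr0n ?expn_gt0//.
  by apply: le_trans Ku; rewrite invf_div /K; lra.
- by rewrite mulrC -ler_pdivrMr// div1r.
- split=> [n|m n _ _ [t [/EP[j Aj] /EP[k Ak]]]].
    by apply: bigsetU_measurable.
  have /pickle_inj[//] : pickle (m, j) = pickle (n, k).
  by apply: tA => //; exists t.
- have -> : mu (E n) = (\sum_(j < N n) mu (A (pickle (n, j : nat))))%E.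
    apply: (@measure_bigsetU _ _ _ mu (fun j => A (pickle (n, j)))) => //.
    by move=> j k _ _ Ajk; have /pickle_inj[] := tA _ _ I I Ajk.
  under eq_bigr do rewrite muA.
  by rewrite sumEFin sumr_const card_ord.
Qed.

End DisjointSupports.

(** * The theorem, by cases on the condition that fails *)

Theorem theorem3 (R : realType) (d : measure_display) (T : measurableType d)
  (mu : {measure set T -> \bar R}) (Nat : option nat) (A : nat -> set T)
  (p : R -> R -> R) (Phi : R -> R) :
  standing_assumptions mu Nat A ->
  lattice_norm p -> p 1 0 = 1 -> p 0 1 = 1 ->
  orlicz_function Phi ->
  ~ suitable_Delta2 Phi (mu (Omega_na Nat A)) Nat ->
  forall eps : R, 0 < eps ->
  exists P : (nat -> R) -> T -> R,
    [/\ (* P maps l^infty into L^Phi(mu) *)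
        (forall z, bounded_seq z -> in_LPhi mu Phi (P z)),
        (* linearity (as a map into classes of a.e. equal functions) *)
        (forall z w (a b : R), bounded_seq z -> bounded_seq w ->
           {ae mu, forall t, P (fun n => a * z n + b * w n) t
                             = a * P z t + b * P w t}),
        (* nonnegativity *)
        (forall z, bounded_seq z -> (forall n, 0 <= z n) ->
           {ae mu, forall t, 0 <= P z t})
      & (* almost isometry *)
        (forall z, bounded_seq z ->
           ((linf_norm z)%:E <= orlicz_pnorm mu Phi p (P z))%E /\
           (orlicz_pnorm mu Phi p (P z) <= ((1 + eps) * linf_norm z)%:E)%E)].
Proof.
move=> [[sf _] atom1 atomA disjA nonatomD] lp p10 p01 oPhi nDelta eps eps0.
suff [E [a [u [[mE tE] muE u0 small large]]]] : Delta2_failing_supports mu Phi eps.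
  exact: (linf_copy _ _ _ _ _ _ _ E a u).
set D := Omega_na Nat A in nonatomD nDelta.
have mD : measurable D.
  by apply/measurableC/bigcup_measurable => k /atomA[].
(* If the condition at 0 fails on infinitely many atoms, the atoms carry the copy. Otherwise the
   atomic clause holds, and the failure comes from a nonatomic part of positive measure. *)
have [[Nat0 nD0]|not0] := pselect (Nat = None /\ ~ Delta2_zero Phi).
  rewrite Nat0 in atomA disjA.
  apply: (@Delta2_zero_supports _ _ _ mu Phi eps oPhi eps0 A) => //.
  - by move=> k; case: (atomA k isT).
  - by move=> k; exact/atom1/atomA.
  - move=> k l _ _ [t Akl]; apply: contrapT => /(disjA k l isT isT) Akl0.
    by rewrite Akl0 in Akl.
have D0 : (0 < mu D)%E.
  apply: contrapT => D0; apply: nDelta; split=> // Nat0.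
  by apply: contrapT => nD0; apply: not0.
have [Doo|Doo] := eqVneq (mu D) +oo%E.
  apply: (@Delta2_Rplus_supports _ _ _ mu Phi eps oPhi eps0 D) => // nDR.
  apply: nDelta; split=> [_|Nat0]; last first.
    by apply: contrapT => nD0; apply: not0.
  by split=> //; rewrite Doo ltxx.
have Dlt : (mu D < +oo)%E by rewrite ltey.
apply: (@Delta2_infty_supports _ _ _ mu Phi eps oPhi eps0 D) => //.
  by rewrite D0.
move=> nDoo; apply: nDelta; split=> [_|Nat0]; last first.
  by apply: contrapT => nD0; apply: not0.
by split=> // Deq; rewrite Deq ltxx in Dlt.
Qed.
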